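(* Let $\omega$ be a non-principal ultrafilter on $\mathbb{N}$. The metric ultraproduct $\prod_{n\to\omega}(\mathrm{SO}(n),\|\cdot\|_{\overline{\mathrm{rk}}})$ of the special orthogonal groups with the projectivised rank metric is contractible.
   Context: $\mathrm{SO}(n)\subset \mathrm{GL}_n(\mathbb{R})$ is the (real) special orthogonal group. The rank norm of $g\in\mathrm{GL}_n(\mathbb{R})$ is $\|g\|_{\mathrm{rk}}=\mathrm{rk}(g-\mathrm{id})$ and the projectivised rank norm is $\|g\|_{\overline{\mathrm{rk}}}=\|g\|_{\mathrm{rk}}/n$; the induced bi-invariant metric is $d_n(g,h)=\|gh^{-1}\|_{\overline{\mathrm{rk}}}$. For a sequence $(G_n,d_n)_{n\ge1}$ of groups with bi-invariant metrics of uniformly bounded diameter, the metric ultraproduct is $$\prod_{n\to\omega}(G_n,d_n)=\prod_nG_n\Big/\{(g_n)_n\mid\lim_\omega d_n(1,g_n)=0\},$$ a metric space (and topological group) with metric $d([g_n],[h_n])=\lim_\omega d_n(g_n,h_n)$. *)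

(* Defs.v *)
From HB Require Import structures.
From mathcomp Require Import all_boot all_order all_algebra.
From mathcomp Require Import generic_quotient.
From mathcomp Require Import all_classical all_reals topology normedtype.

Set Implicit Arguments.
Unset Strict Implicit.
Unset Printing Implicit Defensive.

Import Order.TTheory GRing.Theory Num.Theory.
Import numFieldNormedType.Exports.

Local Open Scope classical_set_scope.
Local Open Scope ring_scope.
Local Open Scope quotient_scope.

Definition homotopic (R : realType) (X Y : topologicalType) (f g : X -> Y) :=
  exists H : R * X -> Y,
    [/\ {within `[0, 1] `*` [set: X], continuous H},
        forall x, H (0, x) = f x
      & forall x, H (1, x) = g x].

Definition contractible (R : realType) (X : topologicalType) :=
  exists c : X, homotopic R (@id X) (fun=> c).

HB.mixin Record isBiinvariant (R : realType) G & Metric R G & Group G := {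
  mdistMl : forall z x y : G, mdist (z * x)%g (z * y)%g = mdist x y;
  mdistMr : forall z x y : G, mdist (x * z)%g (y * z)%g = mdist x y
}.

#[short(type="metricGroupType")]
HB.structure Definition MetricGroup (R : realType) :=
  {G of Metric R G & Group G & isBiinvariant R G}.

Definition uniformly_bounded (R : realType) (G : nat -> metricGroupType R) :=
  exists D : R, forall n (x y : G n), mdist x y <= D.

Section MetricGroupTheory.
Context {R : realType} (G : metricGroupType R).
Implicit Types x y z t : G.

Lemma mdist1Vl x y : mdist 1%g (x^-1 * y)%g = mdist x y.
Proof. by rewrite -(mdistMl x) mulg1 mulVKg. Qed.

Lemma mdistV x y : mdist (x^-1)%g (y^-1)%g = mdist x y.
Proof. by rewrite -(mdistMl x) -(mdistMr y) mulgV mul1g mulgVK metric_sym. Qed.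

Lemma mdistM x y z t : mdist (x * y)%g (z * t)%g <= mdist x z + mdist y t.
Proof. by rewrite -(mdistMr y x) -(mdistMl z y) metric_triangle. Qed.

End MetricGroupTheory.

Section MetricUltraproduct.
Context {R : realType} (w : set_system nat) (wU : UltraFilter w).
Context (G : nat -> metricGroupType R) (GB : uniformly_bounded G).
Implicit Types g h k : forall n, G n.

Definition ultradist g h : R := lim (mdist (g n) (h n) @[n --> w]).

Definition ultranull : set (forall n, G n) :=
  [set g | mdist 1%g (g n) @[n --> w] --> (0 : R)].

Lemma ultradist_cvg g h : mdist (g n) (h n) @[n --> w] --> ultradist g h.
Proof.
have [D GD] := GB; pose f n : R := mdist (g n) (h n).
have fU : UltraFilter (f @ w).
  split=> [|F FF fF]; first exact: fmap_proper_filter.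
  apply/seteqP; split=> // A FA.
  have [//|wA] := in_ultra_setVsetC (f @^-1` A) wU.
  have FnA : F (~` A) by exact: fF.
  have := filterI FA FnA; rewrite setICr => F0.
  by case: (filter_not_empty F (F0 _)).
have := @segment_compact R 0 D; rewrite compact_ultra => /(_ _ fU).
case=> [|l [_ fl]]; last by apply/cvg_ex; exists l.
by apply: nearW => n /=; rewrite in_itv/= mdist_ge0 GD.
Qed.

Lemma ultranullE g h :
  ultranull (fun n => (g n)^-1 * h n)%g <-> ultradist g h = 0.
Proof.
rewrite /ultranull/=.
under eq_fun do rewrite mdist1Vl.
split=> [/(cvg_lim _)|<-]; first exact.
exact: ultradist_cvg.
Qed.

Lemma ultradistxx g : ultradist g g = 0.
Proof.
apply: cvg_lim => //; under eq_fun do rewrite mdistxx.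
exact: cvg_cst.
Qed.

Lemma ultradist_sym g h : ultradist g h = ultradist h g.
Proof. by congr lim; under eq_fun do rewrite metric_sym. Qed.

Lemma ultradist_le g h g' h' g'' h'' :
    (forall n, mdist (g n) (h n) <=
       mdist (g' n) (h' n) + mdist (g'' n) (h'' n)) ->
  ultradist g h <= ultradist g' h' + ultradist g'' h''.
Proof.
move=> le3.
have cvD : mdist (g' n) (h' n) + mdist (g'' n) (h'' n) @[n --> w] -->
    ultradist g' h' + ultradist g'' h'' by apply: cvgD; exact: ultradist_cvg.
by apply: ler_cvg_to (@ultradist_cvg g h) cvD _; exact: nearW.
Qed.

Lemma ultradist_triangle h g k :
  ultradist g k <= ultradist g h + ultradist h k.
Proof. by apply: ultradist_le => n; exact: metric_triangle. Qed.

Lemma ultradist_ge0 g h : 0 <= ultradist g h.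
Proof.
by have := ultradist_triangle h g g; rewrite ultradistxx (ultradist_sym h)
  -mulr2n pmulrn_lge0.
Qed.

Definition ultra_equiv g h : bool :=
  `[< ultranull (fun n => (g n)^-1 * h n)%g >].

Lemma ultra_equivP g h : reflect (ultradist g h = 0) (ultra_equiv g h).
Proof. by apply: (iffP (asboolP _)) => /ultranullE. Qed.

Lemma ultra_equiv_refl : reflexive ultra_equiv.
Proof. by move=> g; apply/ultra_equivP/ultradistxx. Qed.

Lemma ultra_equiv_sym : symmetric ultra_equiv.
Proof.
by move=> g h; apply/ultra_equivP/ultra_equivP; rewrite ultradist_sym.
Qed.

Lemma ultra_equiv_trans : transitive ultra_equiv.
Proof.
move=> h g k /ultra_equivP gh /ultra_equivP hk; apply/ultra_equivP/eqP.
by rewrite eq_le ultradist_ge0 andbT -[0]addr0 -{1}gh -hk ultradist_triangle.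
Qed.

Canonical ultra_equiv_equiv :=
  EquivRel ultra_equiv ultra_equiv_refl ultra_equiv_sym ultra_equiv_trans.

(* The quotient of the product group by the subgroup [ultranull]: [g] and [h]
   are identified when g^-1 h lies in it. *)
Definition metric_ultraproduct : Type := {eq_quot ultra_equiv_equiv}.

HB.instance Definition _ := Choice.on metric_ultraproduct.
HB.instance Definition _ := EqQuotient.on metric_ultraproduct.

Local Notation U := metric_ultraproduct.
Local Notation "\u g" := (\pi_U g) (at level 10).

Lemma ultra_piP g h : \u g = \u h <-> ultradist g h = 0.
Proof. by split=> [/eqmodP/ultra_equivP|/ultra_equivP/eqmodP]. Qed.

Lemma eq_ultra_pi g h : (forall n, g n = h n) -> \u g = \u h.
Proof. by move=> gh; congr (\u _); exact: functional_extensionality_dep. Qed.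

Definition ultra_mdist (x y : U) : R := ultradist (repr x) (repr y).

Lemma ultra_repr g : ultradist (repr (\u g)) g = 0.
Proof. by apply/ultra_piP; rewrite reprK. Qed.

Lemma ultra_mdistE g h : ultra_mdist (\u g) (\u h) = ultradist g h.
Proof.
have half g1 h1 g2 h2 : ultradist g1 g2 = 0 -> ultradist h1 h2 = 0 ->
    ultradist g1 h1 <= ultradist g2 h2.
  move=> g12 h12; apply: le_trans (ultradist_triangle g2 _ _) _.
  rewrite g12 add0r; apply: le_trans (ultradist_triangle h2 _ _) _.
  by rewrite (ultradist_sym h2) h12 addr0.
apply/eqP; rewrite eq_le /ultra_mdist !half ?ultra_repr//;
  by rewrite ultradist_sym ultra_repr.
Qed.

Lemma ultra_mdistxx x : ultra_mdist x x = 0.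
Proof. exact: ultradistxx. Qed.

Lemma ultra_mdist_positivity x y : ultra_mdist x y = 0 -> x = y.
Proof. by move/ultra_piP; rewrite !reprK. Qed.

Lemma ultra_mdist_sym x y : ultra_mdist x y = ultra_mdist y x.
Proof. exact: ultradist_sym. Qed.

Lemma ultra_mdist_triangle y x z :
  ultra_mdist x z <= ultra_mdist x y + ultra_mdist y z.
Proof. exact: ultradist_triangle. Qed.

HB.instance Definition _ := @isMetric.Build R metric_ultraproduct ultra_mdist
  ultra_mdistxx ultra_mdist_positivity ultra_mdist_sym ultra_mdist_triangle.

Lemma mdist_ultraE g h : mdist (\u g) (\u h) = ultradist g h.
Proof. exact: ultra_mdistE. Qed.

Definition ultra_one : U := \u (fun n => 1%g).
Definition ultra_inv (x : U) : U := \u (fun n => (repr x n)^-1%g).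
Definition ultra_mul (x y : U) : U := \u (fun n => (repr x n * repr y n)%g).

Lemma ultra_mulE g h : ultra_mul (\u g) (\u h) = \u (fun n => (g n * h n)%g).
Proof.
apply/ultra_piP/eqP; rewrite eq_le ultradist_ge0 andbT.
rewrite -[0]addr0 -{1}(ultra_repr g) -(ultra_repr h).
by apply: ultradist_le => n; exact: mdistM.
Qed.

Lemma ultra_invE g : ultra_inv (\u g) = \u (fun n => (g n)^-1%g).
Proof.
apply/ultra_piP; rewrite -[RHS](ultra_repr g) [in LHS]/ultradist.
by under eq_fun do rewrite mdistV.
Qed.

Lemma ultra_mulA : associative ultra_mul.
Proof.
elim/quotW=> g; elim/quotW=> h; elim/quotW=> k.
rewrite (ultra_mulE h k) (ultra_mulE g h) !ultra_mulE.
by apply: eq_ultra_pi => n; rewrite mulgA.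
Qed.

Lemma ultra_mul1 : left_id ultra_one ultra_mul.
Proof.
elim/quotW=> g; rewrite ultra_mulE.
by apply: eq_ultra_pi => n; rewrite mul1g.
Qed.

Lemma ultra_mulr1 : right_id ultra_one ultra_mul.
Proof.
elim/quotW=> g; rewrite ultra_mulE.
by apply: eq_ultra_pi => n; rewrite mulg1.
Qed.

Lemma ultra_mulV : left_inverse ultra_one ultra_inv ultra_mul.
Proof.
elim/quotW=> g; rewrite ultra_invE ultra_mulE.
by apply: eq_ultra_pi => n; rewrite mulVg.
Qed.

Lemma ultra_mulrV : right_inverse ultra_one ultra_inv ultra_mul.
Proof.
elim/quotW=> g; rewrite ultra_invE ultra_mulE.
by apply: eq_ultra_pi => n; rewrite mulgV.
Qed.

HB.instance Definition _ := isGroup.Build metric_ultraproduct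
  ultra_mulA ultra_mul1 ultra_mulr1 ultra_mulV ultra_mulrV.

Lemma ultra_mdistMl (z x y : U) : mdist (z * x)%g (z * y)%g = mdist x y.
Proof.
elim/quotW: x => g; elim/quotW: y => h; elim/quotW: z => k.
rewrite [X in mdist X _]ultra_mulE [X in mdist _ X]ultra_mulE.
rewrite !mdist_ultraE [in LHS]/ultradist.
by under eq_fun do rewrite mdistMl.
Qed.

Lemma ultra_mdistMr (z x y : U) : mdist (x * z)%g (y * z)%g = mdist x y.
Proof.
elim/quotW: x => g; elim/quotW: y => h; elim/quotW: z => k.
rewrite [X in mdist X _]ultra_mulE [X in mdist _ X]ultra_mulE.
rewrite !mdist_ultraE [in LHS]/ultradist.
by under eq_fun do rewrite mdistMr.
Qed.

HB.instance Definition _ :=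
  isBiinvariant.Build R metric_ultraproduct ultra_mdistMl ultra_mdistMr.

End MetricUltraproduct.

(* In size 0 the projectivised norm is 0 / 0 = 0; SO(0) is the trivial group,
   and a non-principal ultrafilter ignores the index 0. *)

Definition rank_norm (R : realType) n (g : 'M[R]_n) : nat := \rank (g - 1%:M).

Definition proj_rank_norm (R : realType) n (g : 'M[R]_n) : R :=
  (rank_norm g)%:R / n%:R.

Definition is_SO (R : realType) n : pred 'M[R]_n :=
  fun g => (g *m g^T == 1%:M) && (\det g == 1).

Record SO (R : realType) n := MkSO { SO_mx :> 'M[R]_n; _ : is_SO SO_mx }.

Section SpecialOrthogonal.
Context (R : realType) (n : nat).

HB.instance Definition _ := [isSub for @SO_mx R n].
HB.instance Definition _ := [Choice of SO R n by <:].

Implicit Types g h k : SO R n.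

Lemma SO_mulmxT g : g *m (g : 'M_n)^T = 1%:M.
Proof. by case/andP: (valP g) => /eqP. Qed.

Lemma SO_mulTmx g : (g : 'M_n)^T *m g = 1%:M.
Proof. exact/mulmx1C/SO_mulmxT. Qed.

Lemma SO_det g : \det g = 1.
Proof. by case/andP: (valP g) => _ /eqP. Qed.

Lemma SO_row_free g : row_free g.
Proof. by rewrite row_free_unit unitmxE SO_det unitr1. Qed.

Lemma SO_one_subproof : is_SO (1%:M : 'M[R]_n).
Proof. by rewrite /is_SO trmx1 mulmx1 det1 !eqxx. Qed.

Lemma SO_inv_subproof g : is_SO (g : 'M_n)^T.
Proof. by rewrite /is_SO trmxK SO_mulTmx det_tr SO_det !eqxx. Qed.

Lemma SO_mul_subproof g h : is_SO (g *m h).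
Proof.
rewrite /is_SO trmx_mul mulmxA -(mulmxA (g : 'M_n)) SO_mulmxT mulmx1 SO_mulmxT.
by rewrite det_mulmx !SO_det mulr1 !eqxx.
Qed.

Definition SO_one : SO R n := MkSO SO_one_subproof.
Definition SO_inv g : SO R n := MkSO (SO_inv_subproof g).
Definition SO_mul g h : SO R n := MkSO (SO_mul_subproof g h).

Lemma SO_mulA : associative SO_mul.
Proof. by move=> g h k; apply: val_inj; rewrite /= mulmxA. Qed.

Lemma SO_mul1 : left_id SO_one SO_mul.
Proof. by move=> g; apply: val_inj; rewrite /= mul1mx. Qed.

Lemma SO_mulr1 : right_id SO_one SO_mul.
Proof. by move=> g; apply: val_inj; rewrite /= mulmx1. Qed.

Lemma SO_mulV : left_inverse SO_one SO_inv SO_mul.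
Proof. by move=> g; apply: val_inj; rewrite /= SO_mulTmx. Qed.

Lemma SO_mulrV : right_inverse SO_one SO_inv SO_mul.
Proof. by move=> g; apply: val_inj; rewrite /= SO_mulmxT. Qed.

HB.instance Definition _ :=
  isGroup.Build (SO R n) SO_mulA SO_mul1 SO_mulr1 SO_mulV SO_mulrV.

Definition SO_mdist g h : R := proj_rank_norm (g * h^-1)%g.

Lemma SO_mdistE g h :
  SO_mdist g h = (\rank ((g : 'M_n) - (h : 'M_n)))%:R / n%:R.
Proof.
congr (_%:R / _); rewrite /rank_norm -(SO_mulmxT h) /= -mulmxBl mxrankMfree//.
exact: (SO_row_free (h^-1)%g).
Qed.

Lemma SO_mdistxx g : SO_mdist g g = 0.
Proof. by rewrite SO_mdistE subrr mxrank0 mul0r. Qed.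

Lemma SO_mdist_positivity g h : SO_mdist g h = 0 -> g = h.
Proof.
move=> gh0; apply: val_inj => /=; apply/eqP; rewrite -subr_eq0.
have [n0|n_gt0] := posnP n.
  by rewrite -mxrank_eq0 -leqn0 -[X in (_ <= X)%N]n0 rank_leq_row.
rewrite -mxrank_eq0 -(pnatr_eq0 R); move/eqP: gh0.
by rewrite SO_mdistE mulf_eq0 invr_eq0 !pnatr_eq0 (gtn_eqF n_gt0) orbF.
Qed.

Lemma SO_mdist_sym g h : SO_mdist g h = SO_mdist h g.
Proof. by rewrite !SO_mdistE -mxrank_opp opprB. Qed.

Lemma SO_mdist_triangle h g k : SO_mdist g k <= SO_mdist g h + SO_mdist h k.
Proof.
rewrite !SO_mdistE -mulrDl ler_wpM2r ?invr_ge0// -natrD ler_nat.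
by rewrite -(subrKA (h : 'M_n)) mxrank_add.
Qed.

HB.instance Definition _ := @isMetric.Build R (SO R n) SO_mdist
  SO_mdistxx SO_mdist_positivity SO_mdist_sym SO_mdist_triangle.

Lemma SO_mdistMl k g h : mdist (k * g)%g (k * h)%g = mdist g h.
Proof.
rewrite [LHS]SO_mdistE [RHS]SO_mdistE /= -mulmxBr.
rewrite -mxrank_tr trmx_mul mxrankMfree ?mxrank_tr//.
exact: (SO_row_free (k^-1)%g).
Qed.

Lemma SO_mdistMr k g h : mdist (g * k)%g (h * k)%g = mdist g h.
Proof.
rewrite [LHS]SO_mdistE [RHS]SO_mdistE /= -mulmxBl mxrankMfree//.
exact: SO_row_free.
Qed.

HB.instance Definition _ :=
  isBiinvariant.Build R (SO R n) SO_mdistMl SO_mdistMr.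

End SpecialOrthogonal.

Lemma SO_bounded (R : realType) : uniformly_bounded (SO R).
Proof.
exists 1 => n g h; rewrite [leLHS]SO_mdistE.
have [n0|n_gt0] := posnP n; first by rewrite [X in _ / X%:R]n0 invr0 mulr0.
by rewrite ler_pdivrMr ?ltr0n// mul1r ler_nat rank_leq_row.
Qed.

(* Main.v *)
(* Fix the orthonormal basis e_1, ..., e_n. Composing g with the Householder
   reflection that sends g e to e yields a map straighten e g which fixes e,
   still fixes every vector fixed by g, and differs from g by rank at most one.
   The point is that g |-> straighten e g does not increase rank distances.
   Straightening along e_1, ..., e_k with k = floor(t n) thus moves g to 1 as t
   runs from 0 to 1, and is 1-Lipschitz in g and, up to O(1/n), in t for the
   projectivised rank metric. Reflections have determinant -1, but this is
   repaired at the cost of rank one. As n tends to infinity along w, the O(1/n)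
   errors vanish in the ultraproduct. *)

Require Import Defs.
From mathcomp Require Import all_boot all_order all_algebra zify lra.
From mathcomp Require Import generic_quotient.
From mathcomp Require Import all_classical all_reals topology normedtype.

Set Implicit Arguments.
Unset Strict Implicit.
Unset Printing Implicit Defensive.

Import Order.TTheory GRing.Theory Num.Theory.
Import numFieldNormedType.Exports.

Local Open Scope classical_set_scope.
Local Open Scope ring_scope.
Local Open Scope quotient_scope.

(** * Householder reflections and straightening at one vector *)

Section Householder.
Context {R : realType} {n : nat}.
Implicit Types (e v x : 'rV[R]_n) (g h : 'M[R]_n).

Definition orthogonal_mx g := g *m g^T = 1%:M.

Definition sqnorm v : R := (v *m v^T) 0 0.

(* For [v = 0] this is the identity, because [2 / 0 = 0]. *)
Definition reflection v : 'M[R]_n :=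
  1%:M - (2 / sqnorm v) *: (v^T *m v).

Definition straighten e g := g *m reflection (e *m g - e).

Lemma sqnormE v : v *m v^T = (sqnorm v)%:M.
Proof. exact: mx11_scalar. Qed.

Lemma sqnorm_eq0 v : (sqnorm v == 0) = (v == 0).
Proof.
apply/eqP/eqP => [|->]; last by rewrite /sqnorm mul0mx mxE.
have -> : sqnorm v = \sum_j v 0 j ^+ 2.
  by rewrite /sqnorm mxE; apply: eq_bigr => j _; rewrite mxE expr2.
move/psumr_eq0P => v0; apply/rowP => j; rewrite mxE; apply/eqP.
by rewrite -sqrf_eq0 v0// => i _; exact: sqr_ge0.
Qed.

Lemma reflection_orthogonal v : orthogonal_mx (reflection v).
Proof.
have [->|v0] := eqVneq v 0.
  by rewrite /orthogonal_mx /reflection mulmx0 scaler0 subr0 trmx1 mulmx1.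
have reflT : (reflection v)^T = reflection v.
  by rewrite /reflection linearB/= linearZ/= trmx_mul trmxK trmx1.
rewrite /orthogonal_mx reflT /reflection.
rewrite mulmxBl mul1mx mulmxBr mulmx1 -scalemxAl -scalemxAr scalerA.
(* With P = v^T v and c = 2 / |v|^2, P^2 = |v|^2 P, so the quadratic term is 2 c P and cancels the
   two linear ones. *)
rewrite mulmxA -(mulmxA _ v) sqnormE mul_mx_scalar -scalemxAl scalerA.
rewrite -mulrA mulfVK ?sqnorm_eq0//.
rewrite [_ * 2]mulr_natr mulr2n scalerDl.
by rewrite opprB addrK subrK.
Qed.

Lemma straighten_orthogonal e g :
  orthogonal_mx g -> orthogonal_mx (straighten e g).
Proof.
rewrite /orthogonal_mx /straighten => gO.
by rewrite trmx_mul mulmxA -(mulmxA g) reflection_orthogonal mulmx1.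
Qed.

(** Since g g^T = 1, the column g (e g - e)^T equals (1 - g) e^T. Hence [straighten e g] agrees with
    [g] on every row x with x (1 - g) e^T = 0. *)
Lemma straightenE e g : orthogonal_mx g ->
  straighten e g = g - (2 / sqnorm (e *m g - e)) *:
                       ((1%:M - g) *m e^T *m (e *m g - e)).
Proof.
move=> gO; rewrite /straighten /reflection mulmxBr mulmx1 -scalemxAr mulmxA.
by rewrite [(e *m g - e)^T]linearB/= trmx_mul (mulmxBr g) (mulmxA g) gO -mulmxBl.
Qed.

Lemma straighten_rank e g : (\rank (straighten e g - g)%R <= 1)%N.
Proof.
rewrite /straighten /reflection mulmxBr mulmx1 addrAC subrr sub0r mxrank_opp.
rewrite -scalemxAr scalemxAl mulmxA.
by rewrite (leq_trans (mxrankM_maxr _ _))// rank_leq_row.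
Qed.

Lemma straighten_id e g : e *m g = e -> straighten e g = g.
Proof.
by move=> eg; rewrite /straighten eg subrr /reflection mulmx0 scaler0 subr0 mulmx1.
Qed.

Lemma straighten_fix m (x : 'M_(m, n)) e g :
  orthogonal_mx g -> x *m g = x -> x *m straighten e g = x.
Proof.
move=> gO xg; rewrite straightenE// mulmxBr xg -scalemxAr !mulmxA.
by rewrite (mulmxBr x 1%:M) mulmx1 xg subrr !mul0mx scaler0 subr0.
Qed.

(** As [g] preserves norms, the square expands to 2 |e|^2 - 2 <e g, e>. Up to the factor 2 this is
    the pairing of [e] with the column in [straightenE]. *)
Lemma sqnorm_displacement e g : orthogonal_mx g ->
  (sqnorm (e *m g - e))%:M = 2 *: (e *m (1%:M - g) *m e^T).
Proof.
move=> gO; have tr (a : 'M[R]_1) : a^T = a.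
  by rewrite [a]mx11_scalar tr_scalar_mx.
have eg2 : e *m g *m (e *m g)^T = e *m e^T.
  by rewrite trmx_mul -mulmxA (mulmxA g) gO mul1mx.
have sym : e *m (e *m g)^T = e *m g *m e^T.
  by rewrite -[LHS]tr trmx_mul trmxK.
rewrite -sqnormE [(e *m g - e)^T]linearB/= [LHS]mulmxBl !mulmxBr eg2 sym.
by rewrite mulmx1 mulmxBl opprB scaler_nat mulr2n.
Qed.

Lemma straighten_self e g : orthogonal_mx g -> e *m straighten e g = e.
Proof.
move=> gO; have [eg|] := eqVneq (e *m g) e; first by rewrite straighten_id.
rewrite -subr_eq0 -sqnorm_eq0 => d0.
rewrite straightenE// mulmxBr -scalemxAr !mulmxA scalemxAl [2 / _]mulrC.
(* At [e] the coefficient of the correction is exactly 1, leaving e g - (e g - e). *)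
rewrite -scalerA -sqnorm_displacement// scale_scalar_mx mulVf// mul1mx.
by rewrite subKr.
Qed.

(* [w] below is the subspace on which [g] and [h] agree; the two straightened
   maps agree on the hyperplane of [w] killed by [(1 - g) e^T] and on [e]. *)
Lemma straighten_contract e g h : orthogonal_mx g -> orthogonal_mx h ->
  (\rank (straighten e g - straighten e h)%R <= \rank (g - h)%R)%N.
Proof.
move=> gO hO; pose w := kermx (g - h); pose q := (1%:M - g) *m e^T.
pose k := (w :&: kermx q)%MS.
have agree m (x : 'M_(m, n)) : (x <= w)%MS -> x *m g = x *m h.
  by move/sub_kermxP; rewrite mulmxBr => /subr0_eq.
(* If [e] lies in [k], its displacement under [g] has norm zero, so [g] and [h] both fix [e] and
   neither is changed. *)
have [ek|ek] := boolP (e <= k)%MS.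
  move: ek; rewrite sub_capmx => /andP[/agree eghE /sub_kermxP eq0].
  have eg : e *m g = e.
    apply/subr0_eq/eqP; rewrite -sqnorm_eq0; apply/eqP.
    have := sqnorm_displacement e gO.
    by rewrite -mulmxA eq0 scaler0 => /matrixP/(_ 0 0); rewrite !mxE.
  by rewrite !straighten_id// -eghE.
have kS : (k + e <= kermx (straighten e g - straighten e h)%R)%MS.
  rewrite addsmx_sub; apply/andP; split; apply/sub_kermxP.
    have kw : k *m g = k *m h by apply: agree; exact: capmxSl.
    have kq : k *m (1%:M - g) *m e^T = 0.
      by rewrite -mulmxA; apply/sub_kermxP; exact: capmxSr.
    have kq' : k *m (1%:M - h) *m e^T = 0.
      by rewrite -kq [in LHS]mulmxBr [in RHS]mulmxBr kw.
    rewrite mulmxBr !straightenE// !(mulmxBr k g) !(mulmxBr k h) -!scalemxAr.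
    by rewrite !(mulmxA k) kq kq' kw !mul0mx !scaler0 subrr.
  by rewrite mulmxBr !straighten_self// subrr.
have ltk : (\rank k < \rank (k + e))%N.
  by rewrite (ltn_leqif (mxrank_leqif_sup (addsmxSl k e))) addsmx_sub submx_refl.
(* Cutting [w] by a single column loses at most one dimension; adding [e], which lies outside [k],
   regains it. *)
have wk : (\rank w <= (\rank k).+1)%N.
  by rewrite -(mxrank_mul_ker w q) -[(\rank k).+1]add1n leq_add2r rank_leq_col.
have := leq_trans (leq_trans wk ltk) (mxrankS kS).
rewrite !mxrank_ker leq_subLR => le.
by have := rank_leq_row (straighten e g - straighten e h); lia.
Qed.

Lemma rank_triangle (g h k : 'M[R]_n) :
  (\rank (g - k)%R <= \rank (g - h)%R + \rank (h - k)%R)%N.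
Proof. by rewrite -(subrKA h g) mxrank_add. Qed.

Lemma rank_distC (g h : 'M[R]_n) : \rank (g - h) = \rank (h - g).
Proof. by rewrite -mxrank_opp opprB. Qed.

(** * Straightening along initial segments of the basis *)

Definition straighten_seq := foldl (fun g e => straighten e g).

Lemma straighten_seq_orthogonal s g :
  orthogonal_mx g -> orthogonal_mx (straighten_seq g s).
Proof. by elim: s g => //= e s IHs g gO; exact/IHs/straighten_orthogonal. Qed.

Lemma straighten_seq_contract s g h : orthogonal_mx g -> orthogonal_mx h ->
  (\rank (straighten_seq g s - straighten_seq h s)%R <= \rank (g - h)%R)%N.
Proof.
elim: s g h => //= e s IHs g h gO hO.
apply: leq_trans (IHs _ _ _ _) (straighten_contract _ _ _) => //;
  exact: straighten_orthogonal.
Qed.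

Lemma straighten_seq_rank s g :
  (\rank (straighten_seq g s - g)%R <= size s)%N.
Proof.
elim: s g => [|e s IHs] g /=; first by rewrite subrr mxrank0.
apply: leq_trans (rank_triangle _ (straighten e g) _) _.
by rewrite -addn1 leq_add ?straighten_rank.
Qed.

Lemma straighten_seq_fix s x g :
  orthogonal_mx g -> x *m g = x -> x *m straighten_seq g s = x.
Proof.
elim: s g => //= e s IHs g gO xg.
by apply: IHs; [exact: straighten_orthogonal|exact: straighten_fix].
Qed.

(** The step at [e] makes [e] fixed, and every later step preserves fixed vectors. *)
Lemma straighten_seq_mem s e g :
  orthogonal_mx g -> e \in s -> e *m straighten_seq g s = e.
Proof.
elim: s g => //= f s IHs g gO; rewrite inE => /predU1P[->|es].
  apply: straighten_seq_fix; first exact: straighten_orthogonal.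
  exact: straighten_self.
by apply: IHs => //; exact: straighten_orthogonal.
Qed.

Definition canonical_basis : seq 'rV[R]_n := [seq delta_mx 0 i | i <- enum 'I_n].

Definition straighten_upto k g := straighten_seq g (take k canonical_basis).

Lemma straighten_upto_full k g :
  orthogonal_mx g -> (n <= k)%N -> straighten_upto k g = 1%:M.
Proof.
move=> gO nk; apply/row_matrixP => i; rewrite !rowE mulmx1.
apply: straighten_seq_mem => //; rewrite take_oversize.
  by rewrite map_f// mem_enum.
by rewrite size_map size_enum_ord.
Qed.

(** The longer prefix continues the shorter one by at most |k - l| steps, each of rank at most
    one. *)
Lemma straighten_upto_dist k l g :
  (\rank (straighten_upto k g - straighten_upto l g))%:R
    <= `|k%:R - l%:R| :> R.
Proof.
wlog lk : k l / (l <= k)%N.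
  by move=> H; have [/H//|/ltnW/H] := leqP l k; rewrite rank_distC distrC.
rewrite -natrB// ger0_norm ?ler0n// ler_nat /straighten_upto.
rewrite -{1}(subnKC lk) takeD /straighten_seq foldl_cat.
apply: leq_trans (straighten_seq_rank _ _) _.
by rewrite size_take_min geq_minl.
Qed.

End Householder.

(** * Correction of the determinant *)

Definition first_diag {R : realType} n (a : R) : 'M[R]_n :=
  diag_mx (\row_i (if i == 0%N :> nat then a else 1)).

Lemma first_diag1 (R : realType) n : first_diag n 1 = 1%:M :> 'M[R]_n.
Proof.
by rewrite -diag_const_mx; congr diag_mx; apply/rowP => i; rewrite !mxE if_same.
Qed.

Lemma first_diagM (R : realType) n (a b : R) :
  first_diag n a *m first_diag n b = first_diag n (a * b).
Proof.
rewrite mulmx_diag; congr diag_mx.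
by apply/rowP => i; rewrite !mxE; case: ifP; rewrite ?mul1r.
Qed.

Lemma det_first_diag (R : realType) n (a : R) : \det (first_diag n.+1 a) = a.
Proof.
rewrite det_diag big_ord_recl mxE/= big1 ?mulr1//= => i _.
by rewrite mxE.
Qed.

Lemma first_diag_rank (R : realType) n (a : R) :
  (\rank (first_diag n a - 1%:M)%R <= 1)%N.
Proof.
case: n => [|n]; first by rewrite leqW// rank_leq_row.
have -> : first_diag n.+1 a - 1%:M = (a - 1) *: delta_mx 0 0.
  apply/matrixP => i j; rewrite !mxE.
  have [->|ij] := eqVneq i j; rewrite -!(inj_eq val_inj) /=.
    by case: ifP; rewrite ?mulr1 ?subrr ?mulr0.
  case: andP => [[/eqP i0 /eqP j0]|_]; last by rewrite mulr0 subrr.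
  by case/eqP: ij; apply: val_inj; rewrite /= i0 j0.
by rewrite (leq_trans (mxrank_scale _ _))// mxrank_delta.
Qed.

Section MakeSpecial.
Context {R : realType} {n : nat}.
Implicit Types g : 'M[R]_n.

(* Brings an orthogonal matrix back to SO by flipping at most one coordinate. *)
Definition make_special g := g *m first_diag n (\det g).

Lemma make_special_rank g : (\rank (make_special g - g)%R <= 1)%N.
Proof.
rewrite /make_special -{3}(mulmx1 g) -mulmxBr.
exact: leq_trans (mxrankM_maxr _ _) (first_diag_rank _ _).
Qed.

Lemma make_special_id g : \det g = 1 -> make_special g = g.
Proof. by rewrite /make_special => ->; rewrite first_diag1 mulmx1. Qed.

(** Orthogonality forces (det g)^2 = 1, so the diagonal factor squares to the identity and brings
    the determinant to (det g)^2. *)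
Lemma make_special_SO g : orthogonal_mx g -> is_SO (make_special g).
Proof.
move=> gO; have det2 : \det g * \det g = 1.
  by rewrite -[X in _ * X]det_tr -det_mulmx gO det1.
apply/andP; split; apply/eqP.
  rewrite /make_special trmx_mul [(first_diag _ _)^T]tr_diag_mx mulmxA.
  by rewrite -(mulmxA g) first_diagM det2 first_diag1 mulmx1.
rewrite det_mulmx -[RHS]det2; congr (_ * _).
(* In size 0 there is no coordinate to flip, but every determinant is 1. *)
by case: n g {gO det2} => [|m] g; rewrite ?det_first_diag// !det_mx00.
Qed.

End MakeSpecial.

(** * The approximate contraction of SO(n) *)

Lemma dist_truncn (R : realType) (x y : R) :
  `|(Num.truncn x)%:R - (Num.truncn y)%:R| <= `|x - y| + 1 :> R.
Proof.
wlog xy : x y / x <= y.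
  move=> H; have [/H//|/ltW/H] := leP x y; by rewrite distrC (distrC x).
have txy : (Num.truncn x <= Num.truncn y)%N by exact: le_truncn.
rewrite distrC (distrC x) -natrB// ger0_norm ?ler0n// natrB//.
rewrite ger0_norm ?subr_ge0//.
have [y0|y0] := leP 0 y.
  have := truncn_le y; have := real_truncnS_gt (num_real x).
  rewrite y0 -natr1; lra.
(* Truncation sends negative numbers to 0. *)
have -> : Num.truncn y = 0%N by rewrite truncn_floor leNgt y0.
have := ler0n R (Num.truncn x); lra.
Qed.

Section Contraction.
Context {R : realType}.

Lemma SO_orthogonal n (g : SO R n) : orthogonal_mx g.
Proof. exact: SO_mulmxT. Qed.

(** Defined for every real [t], so that the distance estimate needs no restriction to the unit
    interval. *)
Definition SO_contraction (t : R) n (g : SO R n) : SO R n :=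
  MkSO (make_special_SO (straighten_seq_orthogonal
    (take (Num.truncn (t * n%:R)) canonical_basis) (SO_orthogonal g))).

Lemma SO_contraction0 n (g : SO R n) : SO_contraction 0 g = g.
Proof.
apply: val_inj => /=; rewrite mul0r truncn0 take0.
exact/make_special_id/SO_det.
Qed.

Lemma SO_contraction1 n (g : SO R n) : SO_contraction 1 g = 1%g.
Proof.
apply: val_inj => /=; rewrite mul1r natrK.
rewrite [straighten_seq _ _]straighten_upto_full//; last exact: SO_orthogonal.
by rewrite make_special_id// det1.
Qed.

(** In the error 3 / n, the two determinant corrections account for 2 and the rounding of s n and t
    n for 1. *)
Lemma SO_contraction_dist s t n (g h : SO R n) :
  mdist (SO_contraction s g) (SO_contraction t h)
    <= mdist g h + `|s - t| + 3 / n%:R.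
Proof.
rewrite [leLHS]SO_mdistE [mdist g h]SO_mdistE /=.
set k := Num.truncn (s * _); set l := Num.truncn (t * _).
rewrite -!/(straighten_upto _ _).
set g' := straighten_upto k g; set h' := straighten_upto l h.
have rk : (\rank (make_special g' - make_special h')%R
    <= 2 + \rank ((g : 'M_n) - (h : 'M_n))%R
         + \rank (straighten_upto k h - straighten_upto l h)%R)%N.
  rewrite -[2%N]/(1 + 1)%N -!addnA.
  apply: leq_trans (rank_triangle _ g' _) _; apply: leq_add.
    exact: make_special_rank.
  apply: leq_trans (rank_triangle _ h' _) _; rewrite addnC; apply: leq_add.
    by rewrite rank_distC make_special_rank.
  apply: leq_trans (rank_triangle _ (straighten_upto k h) _) _.
  by rewrite leq_add2r straighten_seq_contract//; exact: SO_orthogonal.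
have kl : `|k%:R - l%:R| <= `|s - t| * n%:R + 1 :> R.
  apply: le_trans (dist_truncn _ _) _.
  by rewrite -mulrBl normrM (ger0_norm (ler0n _ _)).
have := straighten_upto_dist k l (h : 'M_n).
move: rk; rewrite -(ler_nat R) !natrD => rk klh.
(* Only an inequality: for n = 0 the left side is 0. *)
have sE : `|s - t| * n%:R / n%:R <= `|s - t|.
  have [->|n0] := posnP n; first by rewrite invr0 mulr0.
  by rewrite mulfK// pnatr_eq0 -lt0n.
apply: (@le_trans _ _ (((\rank ((g : 'M_n) - (h : 'M_n)))%:R
    + `|s - t| * n%:R + 3) / n%:R)).
  by rewrite ler_wpM2r ?invr_ge0//; lra.
by rewrite !mulrDl lerD2r lerD2l.
Qed.

End Contraction.

(** * Non-principal ultrafilters converge to infinity *)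

Section Nonprincipal.
Context (w : set_system nat) (wU : UltraFilter w).
Context (w_nonprincipal : forall n, w <> principal_filter n).

Lemma nonprincipal_setC1 n : w (~` [set n]).
Proof.
have [wn|//] := in_ultra_setVsetC [set n] wU; case: (@w_nonprincipal n).
apply/seteqP; split=> A.
  move=> wA; apply/principal_filterP.
  by have [m [/= ->]] := filter_ex (filterI wn wA).
by move/principal_filterP => An; apply: filterS wn => m ->.
Qed.

(** Each tail of the naturals is a finite intersection of complements of points. *)
Lemma nonprincipal_infty : w --> \oo.
Proof.
move=> A [N _ NA]; apply: filterS NA _.
elim: N => [|N IHN]; first by apply: filterS filterT => m.
apply: filterS (filterI IHN (nonprincipal_setC1 N)) => m /= [Nm /eqP mN].
by rewrite ltn_neqAle eq_sym mN.
Qed.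

End Nonprincipal.

(** * The homotopy on the ultraproduct *)

Theorem proposition6p10 (R : realType) (w : set_system nat)
    (wU : UltraFilter w) (w_nonprincipal : forall n, w <> principal_filter n) :
  contractible R (metric_ultraproduct wU (SO_bounded R)).
Proof.
pose U := metric_ultraproduct wU (SO_bounded R).
pose F (p : R * U) n := SO_contraction p.1 (repr p.2 n).
pose H (p : R * U) : U := \pi_U (F p).
have inv_cvg0 : (3 / n%:R : R) @[n --> w] --> (0 : R).
  apply: (cvg_comp (fun n => n) (fun n => 3 / n%:R) (G := \oo)).
    exact: nonprincipal_infty w_nonprincipal.
  rewrite -(mulr0 3); apply: cvgM; first exact: cvg_cst.
  apply/gtr0_cvgV0; last exact: cvgr_idn.
  by exists 1%N => // m /=; rewrite ltr0n.
(* The error 3 / n vanishes in the limit along [w], so [H] is 1-Lipschitz for the sum of the two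
   distances, although it is built from chosen representatives. *)
have H_lip s t x y : mdist (H (s, x)) (H (t, y)) <= mdist x y + `|s - t|.
  rewrite mdist_ultraE.
  have cvR : mdist (repr x n) (repr y n) + `|s - t| + 3 / n%:R @[n --> w] -->
      mdist x y + `|s - t| + 0.
    apply: cvgD => //; apply: cvgD; last exact: cvg_cst.
    exact: (@ultradist_cvg _ _ wU _ (SO_bounded R) (repr x) (repr y)).
  have cvL := @ultradist_cvg _ _ wU _ (SO_bounded R) (F (s, x)) (F (t, y)).
  rewrite -[leRHS]addr0; apply: ler_cvg_to cvL cvR _.
  by apply: nearW => n; exact: SO_contraction_dist.
exists 1%g, H; split=> [|x|x].
(* By [H_lip], continuity holds on all of [R * U], hence on the strip. *)
- apply: continuous_subspaceT => -[t x]; apply/cvg_ballP => e e0.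
  have e20 : 0 < e / 2 by rewrite divr_gt0.
  exists (ball t (e / 2), ball x (e / 2)); first by split; exact: nbhsx_ballx.
  move=> [s y] /= [st]; rewrite !ballEmdist /= => xy.
  apply: le_lt_trans (H_lip _ _ _ _) _.
  by rewrite [ltRHS]splitr ltrD.
- rewrite /H -[RHS]reprK; apply: eq_ultra_pi => n; exact: SO_contraction0.
- by apply: eq_ultra_pi => n; exact: SO_contraction1.
Qed.
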